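(* Let $\gamma:\mathbb{R}^2\to\mathbb{R}^3$ be a smooth solution of $\gamma_t=\frac12\gamma_x\times\gamma_{xx}$ parametrized by arc-length, $g=(e_0,e_1,e_2)$ an adapted p-frame along $\gamma$, $k_i(\cdot,t)$ the principal curvature along $e_i(\cdot,t)$ for $i=1,2$, and $q=\frac12(k_1+ik_2)$ the corresponding solution of the NLS. Let $\alpha\in\mathbb{C}\setminus\mathbb{R}$ and let $y=(y_1,y_2)^t:\mathbb{R}^2\to\mathbb{C}^2$ be a nontrivial solution of the linear system $$y_x=\begin{pmatrix}-i\alpha&-q\\ \bar q&i\alpha\end{pmatrix}y,\qquad y_t=\begin{pmatrix}-i\alpha^2+\frac{i}{2}|q|^2&-\alpha q-\frac{i}{2}q_x\\ \alpha\bar q-\frac{i}{2}\bar q_x&i\alpha^2-\frac{i}{2}|q|^2\end{pmatrix}y.$$ Then $$\tilde\gamma=\gamma+\frac{\mathrm{Im}(\alpha)}{\|\alpha y\|^2}\left((|y_2|^2-|y_1|^2)e_0+(y_1\bar y_2+\bar y_1y_2)e_1+\frac1i(y_1\bar y_2-\bar y_1y_2)e_2\right)$$ is a solution of $\tilde\gamma_t=\frac12\tilde\gamma_x\times\tilde\gamma_{xx}$.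
   Context: The NLS is $q_t=\frac{i}{2}(q_{xx}+2|q|^2q)$, and $\|y\|^2=|y_1|^2+|y_2|^2$. An adapted p-frame along an arc-length parametrized solution $\gamma$ of $\gamma_t=\frac12\gamma_x\times\gamma_{xx}$ is a smooth $g=(e_0,e_1,e_2):\mathbb{R}^2\to SO(3)$ with $e_0=\gamma_x$ and, for some real functions $k_1,k_2$ (the principal curvatures along $e_1,e_2$), $$g^{-1}g_x=\begin{pmatrix}0&-k_1&-k_2\\k_1&0&0\\k_2&0&0\end{pmatrix},\quad g^{-1}g_t=\begin{pmatrix}0&\frac{(k_2)_x}{2}&-\frac{(k_1)_x}{2}\\-\frac{(k_2)_x}{2}&0&\frac{k_1^2+k_2^2}{4}\\ \frac{(k_1)_x}{2}&-\frac{k_1^2+k_2^2}{4}&0\end{pmatrix}.$$ Then $q=\frac12(k_1+ik_2)$ solves the NLS. *)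

(* Defs.v *)
From mathcomp Require Import all_boot all_order all_algebra.
From mathcomp Require Import complex.
From mathcomp Require Import boolp classical_sets functions reals topology.
From mathcomp Require Import normedtype derive.

Set Implicit Arguments.
Unset Strict Implicit.
Unset Printing Implicit Defensive.

Import Order.TTheory GRing.Theory Num.Theory.
Import numFieldNormedType.Exports.
Import Normc.

Local Open Scope classical_set_scope.
Local Open Scope ring_scope.

(* Maps on the (x, t)-plane are curried, the space variable x coming first.   *)

Definition dx (R : realType) (V : normedModType R) (f : R -> R -> V) :
  R -> R -> V := fun x t => derive1 (f ^~ t) x.

Definition dt (R : realType) (V : normedModType R) (f : R -> R -> V) :
  R -> R -> V := fun x t => derive1 (f x) t.

Fixpoint Ck (R : realType) (V : normedModType R) (n : nat)
    (f : R -> R -> V) : Prop :=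
  continuous (fun p : R * R => f p.1 p.2) /\
  if n is m.+1 then
    [/\ forall x t, derivable (f ^~ t) x 1,
        forall x t, derivable (f x) t 1,
        Ck m (dx f) & Ck m (dt f)]
  else True.

Definition smooth (R : realType) (V : normedModType R) (f : R -> R -> V) :=
  forall n, Ck n f.

Definition mx_of_rows (T : nmodType) (m n : nat) (s : seq (seq T)) :
  'M[T]_(m, n) := \matrix_(i, j) nth 0 (nth [::] s i) j.

Definition cross (R : realType) (u v : 'cV[R]_3) : 'cV[R]_3 :=
  mx_of_rows 3 1
    [:: [:: u 1 0 * v 2 0 - u 2 0 * v 1 0];
        [:: u 2 0 * v 0 0 - u 0 0 * v 2 0];
        [:: u 0 0 * v 1 0 - u 1 0 * v 0 0]].

(* The library norm on matrices is the sup norm, hence this definition.       *)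
Definition enorm (R : realType) (n : nat) (u : 'cV[R]_n) : R :=
  Num.sqrt (\sum_i u i 0 ^+ 2).

Definition vfe_solution (R : realType) (gamma : R -> R -> 'cV[R]_3) : Prop :=
  smooth gamma /\
  forall x t, dt gamma x t = 2^-1 *: cross (dx gamma x t) (dx (dx gamma) x t).

Definition arc_length (R : realType) (gamma : R -> R -> 'cV[R]_3) : Prop :=
  forall x t, enorm (dx gamma x t) = 1.

Definition SO3 (R : realType) (g : 'M[R]_3) : Prop :=
  g^T *m g = 1%:M /\ \det g = 1.

(* The vectors e_0, e_1, e_2 of the frame are the columns of g.               *)
Definition adapted_pframe (R : realType) (gamma : R -> R -> 'cV[R]_3)
    (g : R -> R -> 'M[R]_3) (k1 k2 : R -> R -> R) : Prop :=
  [/\ smooth g,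
      forall x t, SO3 (g x t),
      forall x t, col 0 (g x t) = dx gamma x t,
      forall x t, invmx (g x t) *m dx g x t =
        mx_of_rows 3 3
          [:: [:: 0; - k1 x t; - k2 x t];
              [:: k1 x t; 0; 0];
              [:: k2 x t; 0; 0]] &
      forall x t, invmx (g x t) *m dt g x t =
        mx_of_rows 3 3
          [:: [:: 0; dx k2 x t / 2; - (dx k1 x t / 2)];
              [:: - (dx k2 x t / 2); 0; (k1 x t ^+ 2 + k2 x t ^+ 2) / 4];
              [:: dx k1 x t / 2; - ((k1 x t ^+ 2 + k2 x t ^+ 2) / 4); 0]]].

(* The library puts no normed R-module structure on R[i], so derivatives of   *)
(* complex-valued maps of a real variable are taken on real and imaginary     *)
(* parts.                                                                     *)
Definition dxC (R : realType) (f : R -> R -> R[i]) : R -> R -> R[i] :=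
  fun x t => Complex (dx (fun x t => complex.Re (f x t)) x t)
                     (dx (fun x t => complex.Im (f x t)) x t).

Definition is_cvderive (R : realType) (n : nat) (x : R) (f : R -> 'cV[R[i]]_n)
    (df : 'cV[R[i]]_n) : Prop :=
  forall j, is_derive x (1 : R) (fun s => complex.Re (f s j 0))
                                (complex.Re (df j 0)) /\
            is_derive x (1 : R) (fun s => complex.Im (f s j 0))
                                (complex.Im (df j 0)).

Definition q_of (R : realType) (k1 k2 : R -> R -> R) : R -> R -> R[i] :=
  fun x t => 2^-1 * ((k1 x t)%:C%C + 'i * (k2 x t)%:C%C).

Definition lax_x (R : realType) (alpha : R[i]) (q : R -> R -> R[i]) (x t : R) :
    'M[R[i]]_2 :=
  mx_of_rows 2 2
    [:: [:: - 'i * alpha; - q x t];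
        [:: (q x t)^*; 'i * alpha]].

Definition lax_t (R : realType) (alpha : R[i]) (q : R -> R -> R[i]) (x t : R) :
    'M[R[i]]_2 :=
  let qbar := fun x t => (q x t)^* in
  mx_of_rows 2 2
    [:: [:: - 'i * alpha ^+ 2 + 'i / 2 * `|q x t| ^+ 2;
            - alpha * q x t - 'i / 2 * dxC q x t];
        [:: alpha * qbar x t - 'i / 2 * dxC qbar x t;
            'i * alpha ^+ 2 - 'i / 2 * `|q x t| ^+ 2]].

Definition lax_solution (R : realType) (alpha : R[i]) (q : R -> R -> R[i])
    (y : R -> R -> 'cV[R[i]]_2) : Prop :=
  forall x t, is_cvderive x (y ^~ t) (lax_x alpha q x t *m y x t) /\
              is_cvderive t (y x) (lax_t alpha q x t *m y x t).

Definition cnorm2 (R : realType) (v : 'cV[R[i]]_2) : R :=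
  normc (v 0 0) ^+ 2 + normc (v 1 0) ^+ 2.

(* The coefficients of e_1 and e_2 are real complex numbers; complex.Re only  *)
(* moves them from R[i] to R.                                                 *)
Definition gamma_tilde (R : realType) (gamma : R -> R -> 'cV[R]_3)
    (g : R -> R -> 'M[R]_3) (alpha : R[i]) (y : R -> R -> 'cV[R[i]]_2) :
  R -> R -> 'cV[R]_3 := fun x t =>
  let y1 := y x t 0 0 in
  let y2 := y x t 1 0 in
  gamma x t + (complex.Im alpha / cnorm2 (alpha *: y x t)) *:
    ((normc y2 ^+ 2 - normc y1 ^+ 2) *: col 0 (g x t)
     + complex.Re (y1 * y2^* + y1^* * y2) *: col 1 (g x t)
     + complex.Re ('i^-1 * (y1 * y2^* - y1^* * y2)) *: col 2 (g x t)).

(* Main.v *)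
Require Import Defs.
From mathcomp Require Import all_boot all_order all_algebra.
From mathcomp Require Import complex.
From mathcomp Require Import boolp classical_sets functions reals topology.
From mathcomp Require Import normedtype derive.
From mathcomp Require Import sequences realfun exp.
From mathcomp Require Import ring lra.

(* Write a = Re alpha, b = Im alpha and let n = (u, v, w) be the unit vector  *)
(* whose frame coordinates are the Hopf image of y, so that                   *)
(* gamma_tilde = gamma + c g n with c = b / (a^2 + b^2). The Lax system for y *)
(* turns into an ODE for n in each variable that only involves u, v, w, the   *)
(* principal curvatures and their x-derivatives. Hence dx gamma_tilde = g A,  *)
(* dx dx gamma_tilde = g B and dt gamma_tilde = g T with explicit A, B and T. *)
(* Since rotations preserve the cross product, the equation amounts to        *)
(* T = 1/2 A x B, a polynomial identity modulo u^2 + v^2 + w^2 = 1 and        *)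
(* c (a^2 + b^2) = b.                                                         *)
(* As y is only assumed to satisfy the Lax system pointwise, its smoothness   *)
(* and the fact that it vanishes nowhere come from Gronwall estimates for     *)
(* linear systems with smooth coefficients in both variables.                 *)

Set Implicit Arguments.
Unset Strict Implicit.
Unset Printing Implicit Defensive.

Import Order.TTheory GRing.Theory Num.Theory.
Import numFieldNormedType.Exports.
Import Normc.

Local Open Scope classical_set_scope.
Local Open Scope ring_scope.

(** * Calculus of Ck maps on the plane *)

(** The new curve stays at the constant distance |c| from gamma, and the unit direction g n joining
    them evolves simply. Since g_x = g [Mx], its x-derivative is g (n_x + [Mx] n), and
    [is_derive_hopf_x] gives n_x + [Mx] n = 2a n x e_0 + 2b ((n . e_0) n - e_0): the curvature terms
    of the Lax matrix cancel those of the frame. In t, by [is_derive_hopf_t], the terms of n_t +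
    [Mt] n with x-derivatives of the curvatures or with k1^2 + k2^2 cancel in the same way. Both
    sides of the equation thus become polynomials in u, v, w, a, b, c, k1, k2, which [backlund_vfe]
    compares after [cross_mulmx] has removed the rotation g.

    The analytic part makes n well defined and smooth. A zero of y would propagate to the whole
    plane ([plane_system_zero]), so a nontrivial y vanishes nowhere. A pointwise solution y is
    jointly continuous ([plane_system_continuous]), and the system itself then raises its regularity
    order by order ([plane_system_smooth]). *)

Lemma is_derive_mxP (R : realFieldType) (m n : nat) (M : R -> 'M[R]_(m, n))
    (x : R) (dM : 'M[R]_(m, n)) :
  is_derive x 1 M dM <->
  forall i j, is_derive x (1 : R) (fun s => M s i j) (dM i j).
Proof.
split=> [[dv <-] i j | H].
  by rewrite derive_mx // mxE; apply/derivableP; move: i j; apply/derivable_mxP.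
have dv : derivable M x 1 by apply/derivable_mxP => i j; case: (H i j).
apply: DeriveDef => //; rewrite derive_mx //; apply/matrixP => i j.
by rewrite mxE; case: (H i j).
Qed.

Lemma is_derive_fsum (R : realFieldType) (I : finType) (f : I -> R -> R)
    (x : R) (df : I -> R) :
  (forall i, is_derive x 1 (f i) (df i)) ->
  is_derive x 1 (fun s => \sum_i f i s) (\sum_i df i).
Proof.
move=> H; elim: (index_enum I) => [|i s IH].
  rewrite big_nil (_ : (fun _ => _) = cst 0); first exact: is_derive_cst.
  by apply/funext => u; rewrite big_nil.
rewrite big_cons (_ : (fun _ => _) = f i + (fun u => \sum_(j <- s) f j u)).
  exact: is_deriveD.
by apply/funext => u; rewrite big_cons.
Qed.

Lemma is_derive_mulmx (R : realFieldType) (m n p : nat)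
    (A : R -> 'M[R]_(m, n)) (B : R -> 'M[R]_(n, p)) (x : R) dA dB :
  is_derive x 1 A dA -> is_derive x 1 B dB ->
  is_derive x 1 (fun s => A s *m B s) (dA *m B x + A x *m dB).
Proof.
move=> /is_derive_mxP HA /is_derive_mxP HB; apply/is_derive_mxP => i j.
under eq_fun do rewrite mxE.
apply: (is_derive_eq (is_derive_fsum (fun k => is_deriveM (HA i k) (HB k j)))).
rewrite !mxE -big_split; apply: eq_bigr => k _ /=.
by rewrite addrC /GRing.scale /= [B x k j * _]mulrC.
Qed.

Section plane_maps.
Context {R : realType}.

Lemma dxE (V : normedModType R) (f : R -> R -> V) (x t : R) df :
  is_derive x 1 (f ^~ t) df -> dx f x t = df.
Proof. by move=> H; rewrite /dx derive1E derive_val. Qed.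

Lemma dtE (V : normedModType R) (f : R -> R -> V) (x t : R) df :
  is_derive t 1 (f x) df -> dt f x t = df.
Proof. by move=> H; rewrite /dt derive1E derive_val. Qed.

Lemma CkW (V : normedModType R) n (f : R -> R -> V) : Ck n.+1 f -> Ck n f.
Proof.
elim: n f => [|n IH] f; first by case.
by move=> [cf [dx1 dt1 /IH hx /IH ht]]; split.
Qed.

Lemma Ck_continuous (V : normedModType R) n (f : R -> R -> V) :
  Ck n f -> continuous (fun p : R * R => f p.1 p.2).
Proof. by case: n => [|n] []. Qed.

Lemma Ck_dx (V : normedModType R) n (f : R -> R -> V) (x t : R) :
  Ck n.+1 f -> is_derive x 1 (f ^~ t) (dx f x t).
Proof. by move=> [_ [H _ _ _]]; rewrite /dx derive1E; apply/derivableP. Qed.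

Lemma Ck_dt (V : normedModType R) n (f : R -> R -> V) (x t : R) :
  Ck n.+1 f -> is_derive t 1 (f x) (dt f x t).
Proof. by move=> [_ [_ H _ _]]; rewrite /dt derive1E; apply/derivableP. Qed.

(** Introduction rule for [Ck] with explicit candidates for the partial derivatives. All closure
    properties below are inductions on the order that pass through it. *)
Lemma CkS (V : normedModType R) n (f fx ft : R -> R -> V) :
  continuous (fun p : R * R => f p.1 p.2) ->
  (forall x t : R, is_derive x 1 (f ^~ t) (fx x t)) ->
  (forall x t : R, is_derive t 1 (f x) (ft x t)) ->
  Ck n fx -> Ck n ft -> Ck n.+1 f.
Proof.
move=> cf hx ht cx ct; split => //; split=> [x t|x t||].
- by case: (hx x t).
- by case: (ht x t).
- by rewrite (_ : dx f = fx) //; apply/funext => x; apply/funext => t; apply: dxE.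
- by rewrite (_ : dt f = ft) //; apply/funext => x; apply/funext => t; apply: dtE.
Qed.

Lemma Ck_cst (V : normedModType R) n (c : V) : Ck n (fun _ _ : R => c).
Proof.
elim: n c => [|n IH] c; first by split=> // p; exact: cvg_cst.
apply: (@CkS _ _ _ (fun _ _ => 0) (fun _ _ => 0)) => // [p|x t].
  exact: cvg_cst.
exact: is_derive_cst.
Qed.

Lemma CkD (V : normedModType R) n (f g : R -> R -> V) :
  Ck n f -> Ck n g -> Ck n (fun x t => f x t + g x t).
Proof.
elim: n f g => [|n IH] f g F G.
  split=> // p; apply: (@continuousD _ _ _ (fun p => f p.1 p.2) (fun p => g p.1 p.2)).
    exact: (Ck_continuous F).
  exact: (Ck_continuous G).
apply: (@CkS _ _ _ (fun x t => dx f x t + dx g x t) (fun x t => dt f x t + dt g x t)).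
- move=> p; apply: (@continuousD _ _ _ (fun p => f p.1 p.2) (fun p => g p.1 p.2)).
    exact: (Ck_continuous F).
  exact: (Ck_continuous G).
- by move=> x t; apply: (@is_deriveD _ _ _ (f^~t) (g^~t)); apply: Ck_dx; eassumption.
- by move=> x t; apply: (@is_deriveD _ _ _ (f x) (g x)); apply: Ck_dt; eassumption.
- by apply: IH; [case: F => _ []|case: G => _ []].
- by apply: IH; [case: F => _ []|case: G => _ []].
Qed.

Lemma CkM n (f g : R -> R -> R) :
  Ck n f -> Ck n g -> Ck n (fun x t => f x t * g x t).
Proof.
elim: n f g => [|n IH] f g F G.
  split=> // p; apply: (@continuousM _ _ (fun p => f p.1 p.2) (fun p => g p.1 p.2)).
    exact: (Ck_continuous F).
  exact: (Ck_continuous G).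
apply: (@CkS _ _ _ (fun x t => f x t * dx g x t + g x t * dx f x t)
  (fun x t => f x t * dt g x t + g x t * dt f x t)).
- move=> p; apply: (@continuousM _ _ (fun p => f p.1 p.2) (fun p => g p.1 p.2)).
    exact: (Ck_continuous F).
  exact: (Ck_continuous G).
- by move=> x t; apply: (@is_deriveM _ _ (f^~t) (g^~t)); apply: Ck_dx; eassumption.
- by move=> x t; apply: (@is_deriveM _ _ (f x) (g x)); apply: Ck_dt; eassumption.
- by apply: CkD; apply: IH; try (by apply: CkW);
    [case: G => _ []|case: F => _ []].
- by apply: CkD; apply: IH; try (by apply: CkW);
    [case: G => _ []|case: F => _ []].
Qed.

Lemma CkN n (f : R -> R -> R) : Ck n f -> Ck n (fun x t => - f x t).
Proof.
move=> F; rewrite (_ : (fun x t => _) = fun x t => (fun _ _ => -1) x t * f x t).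
  by apply: CkM => //; apply: Ck_cst.
by apply/funext => x; apply/funext => t; rewrite mulN1r.
Qed.

Lemma CkB n (f g : R -> R -> R) :
  Ck n f -> Ck n g -> Ck n (fun x t => f x t - g x t).
Proof. by move=> F G; apply: CkD => //; apply: CkN. Qed.

(** The derivative -f'/f^2 contains 1/f only undifferentiated, so the result at order n gives the
    one at order n + 1. *)
Lemma CkV n (f : R -> R -> R) :
  (forall x t, f x t != 0) -> Ck n f -> Ck n (fun x t => (f x t)^-1).
Proof.
move=> f0; have cV : forall m, Ck m f -> continuous (fun p : R * R => (f p.1 p.2)^-1).
  move=> m F p; apply: (@continuousV _ _ (fun p => f p.1 p.2)) => //.
  exact: (Ck_continuous F).
elim: n => [|n IH] F; first by split=> //; apply: cV F.
have IV := IH (CkW F); have cf := cV _ F; case: (F) => _ [_ _ Fx Ft].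
apply: (@CkS _ _ _ (fun x t => - (f x t)^-1 * (f x t)^-1 * dx f x t)
  (fun x t => - (f x t)^-1 * (f x t)^-1 * dt f x t)) => //.
- move=> x t; have D := @is_deriveV _ (f^~t) _ _ _ (f0 x t) (Ck_dx _ _ F).
  by apply: (is_derive_eq D); rewrite /GRing.scale /= -exprVn expr2 -mulNr.
- move=> x t; have D := @is_deriveV _ (f x) _ _ _ (f0 x t) (Ck_dt _ _ F).
  by apply: (is_derive_eq D); rewrite /GRing.scale /= -exprVn expr2 -mulNr.
- by apply: CkM => //; apply: CkM => //; apply: CkN.
- by apply: CkM => //; apply: CkM => //; apply: CkN.
Qed.

Lemma Ck_sum n (I : finType) (f : I -> R -> R -> R) :
  (forall i, Ck n (f i)) -> Ck n (fun x t => \sum_i f i x t).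
Proof.
move=> F; elim: (index_enum I) => [|i s IH].
  rewrite (_ : (fun x t => _) = fun _ _ => 0); first exact: Ck_cst.
  by apply/funext => x; apply/funext => t; rewrite big_nil.
rewrite (_ : (fun x t => _) = fun x t => f i x t + \sum_(j <- s) f j x t).
  exact: CkD.
by apply/funext => x; apply/funext => t; rewrite big_cons.
Qed.

Lemma continuous_mxP (T : topologicalType) m n (M : T -> 'M[R]_(m, n)) :
  continuous M <-> forall i j, continuous (fun p => M p i j).
Proof.
split=> [cM i j p|H p].
  apply: (@continuous_comp _ _ _ M (fun N => N i j)); first exact: cM.
  exact: coord_continuous.
apply/cvgrPdist_le => /= e e0.
near=> s.
rewrite /Num.Def.normr/= mx_normrE (bigmax_le _ (ltW e0))//= => i _.
rewrite !mxE/=.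
move: i; near: s; apply: filter_forall => /= i.
exact: ((cvgrPdist_le _ _).1 (H i.1 i.2 p)).
Unshelve. all: by end_near. Qed.

Lemma Ck_mxP k m n (M : R -> R -> 'M[R]_(m, n)) :
  Ck k M <-> forall i j, Ck k (fun x t => M x t i j).
Proof.
elim: k M => [|k IH] M.
  split=> [[/continuous_mxP cM _] i j|H]; first by split=> //; apply: cM.
  by split=> //; apply/continuous_mxP => i j; case: (H i j).
split=> [HM i j|H].
  apply: (@CkS _ _ _ (fun x t => dx M x t i j) (fun x t => dt M x t i j)).
  - by have /continuous_mxP := Ck_continuous HM; apply.
  - by move=> x t; have /is_derive_mxP := Ck_dx x t HM; apply.
  - by move=> x t; have /is_derive_mxP := Ck_dt x t HM; apply.
  - by move: i j; apply/IH; case: HM => _ [].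
  - by move: i j; apply/IH; case: HM => _ [].
apply: (@CkS _ _ _
  (fun x t => \matrix_(i, j) dx (fun x t => M x t i j) x t)
  (fun x t => \matrix_(i, j) dt (fun x t => M x t i j) x t)).
- by apply/continuous_mxP => i j; apply: (Ck_continuous (H i j)).
- by move=> x t; apply/is_derive_mxP => i j; rewrite mxE; apply: Ck_dx (H i j).
- by move=> x t; apply/is_derive_mxP => i j; rewrite mxE; apply: Ck_dt (H i j).
- apply/IH => i j; under eq_fun do under eq_fun do rewrite mxE.
  by case: (H i j) => _ [].
- apply/IH => i j; under eq_fun do under eq_fun do rewrite mxE.
  by case: (H i j) => _ [].
Qed.

Lemma Ck_mulmx k m n p (A : R -> R -> 'M[R]_(m, n))
    (B : R -> R -> 'M[R]_(n, p)) :
  Ck k A -> Ck k B -> Ck k (fun x t => A x t *m B x t).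
Proof.
move=> /Ck_mxP HA /Ck_mxP HB; apply/Ck_mxP => i j.
under eq_fun do under eq_fun do rewrite mxE.
by apply: Ck_sum => l; apply: CkM.
Qed.

End plane_maps.

(** * Linear systems in two variables *)

Section linear_systems.
Context {R : realType}.

(** The ball around a replaces the segment so that b may lie on either side of a; the estimates
    below are then free of case distinctions. *)
Lemma MVT_ball (f df : R -> R) (a b : R) :
  (forall s, `|s - a| <= `|b - a| -> is_derive s 1 f (df s)) ->
  exists2 c, `|c - a| <= `|b - a| & f b - f a = df c * (b - a).
Proof.
move=> H; have [ab|/ltW ba] := leP a b.
  have sub s : s \in `[a, b] -> `|s - a| <= `|b - a|.
    by rewrite in_itv /= => /andP[as_ sb]; rewrite !ger0_norm ?subr_ge0 // lerB.
  have [||c /sub hc e] := @MVT_segment R f df a b ab; last by exists c.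
  - by move=> s /subset_itv_oo_cc /sub; exact: H.
  - by apply: derivable_within_continuous => s /sub /H [].
have sub s : s \in `[b, a] -> `|s - a| <= `|b - a|.
  by rewrite in_itv /= => /andP[bs sa]; rewrite !ler0_norm ?subr_le0 // lerN2 lerB.
have [||c /sub hc e] := @MVT_segment R f df b a ba.
- by move=> s /subset_itv_oo_cc /sub; exact: H.
- by apply: derivable_within_continuous => s /sub /H [].
by exists c => //; rewrite -opprB e -mulrN opprB.
Qed.

(** The mean value theorem is applied to f(s) exp(-k (s - a)), whose derivative (f' - k f) exp(-k (s
    - a)) has the sign opposite to that of b - a, or vanishes. *)
Lemma gronwall (f df : R -> R) (K a b : R) :
  (forall s, `|s - a| <= `|b - a| -> is_derive s 1 f (df s)) ->
  (forall s, `|s - a| <= `|b - a| -> `|df s| <= K * f s) ->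
  f b <= f a * expR (K * `|b - a|).
Proof.
(* This sign makes k (b - a) = K |b - a|, which treats both directions at once. *)
move=> Hd Hb; pose k := if a <= b then K else - K.
have kK : k * (b - a) = K * `|b - a|.
  rewrite /k; case: leP => ab; first by rewrite ger0_norm ?subr_ge0.
  by rewrite ltr0_norm ?subr_lt0 // mulNr mulrN.
pose e s := expR (- k * (s - a)).
have De (s : R) : is_derive s 1 e (e s * - k).
  have lin : is_derive s 1 (fun s => - k * (s - a)) (- k).
    have D := is_deriveZ (- k) (is_deriveB (is_derive_id s 1) (is_derive_cst a s 1)).
    by apply: (is_derive_eq D); rewrite subr0 /GRing.scale /= mulr1.
  exact: (is_derive1_comp (is_derive_expR _) lin).
have De' (s : R) : `|s - a| <= `|b - a| ->
    is_derive s 1 (fun s => f s * e s) ((df s - k * f s) * e s).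
  move=> /Hd fs; apply: is_derive_eq (is_deriveM fs (De s)) _.
  by rewrite /GRing.scale /=; ring.
have [c hc E] := MVT_ball De'.
have : f b * e b <= f a.
  have ea : e a = 1 by rewrite /e subrr mulr0 expR0.
  move: E; rewrite ea mulr1 -subr_le0 => ->; rewrite mulrAC pmulr_lle0 ?expR_gt0 //.
  have := Hb _ hc; rewrite ler_norml => /andP[h1 h2]; rewrite /k.
  case: (leP a b) => ab.
    by apply: mulr_le0_ge0; rewrite ?subr_ge0 // subr_le0.
  by apply: mulr_ge0_le0; rewrite ?subr_le0 ?(ltW ab) // mulNr opprK -lerBlDr sub0r.
by rewrite -ler_pdivlMr ?expR_gt0 // /e mulNr kK expRN invrK.
Qed.

(* The majorant 1 + A^2 of |A| is smooth as soon as the coefficients are. *)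
Definition coef_bound (I : finType) (A : I -> I -> R) : R :=
  \sum_i \sum_j (1 + A i j * A i j).

Lemma ler_norm_sqr (u : R) : `|u| <= 1 + u * u.
Proof. by rewrite ler_norml; apply/andP; split; nra. Qed.

Lemma coef_bound_ge (I : finType) (A : I -> I -> R) i :
  \sum_j `|A i j| <= coef_bound A.
Proof.
have h u : 0 <= 1 + u * u :> R by rewrite -expr2 addr_ge0 ?sqr_ge0.
rewrite /coef_bound [leRHS](bigD1 i) //= -[leLHS]addr0 lerD //.
  by apply: ler_sum => j _; exact: ler_norm_sqr.
by do 2![apply: sumr_ge0 => ? _].
Qed.

Lemma coef_bound_ge_all (I : finType) (A : I -> I -> R) :
  \sum_i \sum_j `|A i j| <= coef_bound A.
Proof. by do 2![apply: ler_sum => ? _]; exact: ler_norm_sqr. Qed.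

(** The squared Euclidean norm, chosen because it stays differentiable where y vanishes. *)
Definition energy (I : finType) (y : I -> R) : R := \sum_i y i * y i.

Lemma energy_ge0 (I : finType) (y : I -> R) : 0 <= energy y.
Proof. by apply: sumr_ge0 => i _; rewrite -expr2 sqr_ge0. Qed.

Lemma energy_ge (I : finType) (y : I -> R) i : y i * y i <= energy y.
Proof.
rewrite /energy (bigD1 i) //= lerDl.
by apply: sumr_ge0 => j _; rewrite -expr2 sqr_ge0.
Qed.

Lemma energy_eq0 (I : finType) (y : I -> R) i : energy y = 0 -> y i = 0.
Proof. by move=> e; have := energy_ge y i; rewrite e; nra. Qed.

(** The derivative of the energy E is twice the quadratic form of A at y, hence at most 2 K E in
    absolute value, and [gronwall] applies. *)
Lemma energy_growth (I : finType) (A : I -> I -> R -> R) (y : I -> R -> R)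
    (a b K : R) :
  (forall s, `|s - a| <= `|b - a| ->
     forall i, is_derive s 1 (y i) (\sum_j A i j s * y j s)) ->
  (forall s, `|s - a| <= `|b - a| -> coef_bound (fun i j => A i j s) <= K) ->
  energy (y^~ b) <= energy (y^~ a) * expR (2 * K * `|b - a|).
Proof.
move=> Hy HK.
pose df s := \sum_i \sum_j 2 * (A i j s * (y i s * y j s)).
apply: (@gronwall (fun s => energy (y^~ s)) df) => s hs.
  have H i := is_deriveM (Hy s hs i) (Hy s hs i).
  apply: (is_derive_eq (is_derive_fsum H)).
  rewrite /df; apply: eq_bigr => i _.
  rewrite /GRing.scale /= mulr_sumr -big_split /=.
  by apply: eq_bigr => j _; ring.
rewrite /df; under eq_bigr do rewrite -mulr_sumr.
rewrite -mulr_sumr normrM ger0_norm // -mulrA ler_pM2l //.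
apply: le_trans (ler_norm_sum _ _ _) _.
apply: (@le_trans _ _ ((\sum_i \sum_j `|A i j s|) * energy (y^~ s))).
  rewrite mulr_suml; apply: ler_sum => i _.
  rewrite mulr_suml; apply: le_trans (ler_norm_sum _ _ _) _.
  apply: ler_sum => j _; rewrite normrM ler_wpM2l //.
  (* |y_i y_j| is at most the mean of y_i^2 and y_j^2, each of which is at most the energy. *)
  have := energy_ge (y^~ s) i; have := energy_ge (y^~ s) j.
  by rewrite ler_norml => h1 h2; apply/andP; split; nra.
rewrite ler_wpM2r ?energy_ge0 //; apply: le_trans (HK _ hs).
exact: coef_bound_ge_all.
Qed.

Lemma continuous_bounded_ball (f : R -> R) (a r : R) : continuous f ->
  exists K, forall s, `|s - a| <= r -> f s <= K.
Proof.
move=> cf; have [r0|r0] := leP 0 r; last first.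
  by exists 0 => s hs; have := le_trans (normr_ge0 _) hs; rewrite leNgt r0.
have ar : a - r <= a + r by lra.
have [c _ H] := EVT_max ar (continuous_subspaceT cf).
exists (f c) => s; rewrite ler_distl => hs; apply: H.
by rewrite in_itv.
Qed.

(** Continuous coefficients are bounded between a and b, so the Gronwall bound is a multiple of the
    initial energy, which is 0. *)
Lemma linear_system_zero (I : finType) (A : I -> I -> R -> R)
    (y : I -> R -> R) (a b : R) :
  (forall (s : R) i, is_derive s 1 (y i) (\sum_j A i j s * y j s)) ->
  continuous (fun s => coef_bound (fun i j => A i j s)) ->
  energy (y^~ a) = 0 -> energy (y^~ b) = 0.
Proof.
move=> Hy cA y0; have [K HK] := continuous_bounded_ball a (`|b - a|) cA.
have := energy_growth (fun s _ => Hy s) HK.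
by rewrite y0 mul0r => ?; apply/eqP; rewrite eq_le energy_ge0 andbT.
Qed.

Lemma is_derive_continuous (f : R -> R) (s df : R) :
  is_derive s 1 f df -> {for s, continuous f}.
Proof. by move=> [H _]; apply/differentiable_continuous/derivable1_diffP. Qed.

(** * Real linear systems in x and t with smooth coefficients *)

Section plane.
Variables (I : finType) (A B : I -> I -> R -> R -> R) (Y : I -> R -> R -> R).
Hypothesis smooth_A : forall i j, smooth (A i j).
Hypothesis smooth_B : forall i j, smooth (B i j).
Hypothesis Y_x : forall i (x t : R),
  is_derive x 1 (Y i ^~ t) (\sum_j A i j x t * Y j x t).
Hypothesis Y_t : forall i (x t : R),
  is_derive t 1 (Y i x) (\sum_j B i j x t * Y j x t).

Let smooth_bound (C : I -> I -> R -> R -> R) : (forall i j, smooth (C i j)) ->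
  smooth (fun x t => coef_bound (fun i j => C i j x t)).
Proof.
move=> HC n; apply: Ck_sum => i; apply: Ck_sum => j.
by apply: CkD; [exact: Ck_cst|apply: CkM; exact: HC].
Qed.

(** The zero travels along the line t = t0 to (x, t0), then along the vertical line to (x, t). *)
Lemma plane_system_zero (x0 t0 x t : R) :
  energy (fun i => Y i x0 t0) = 0 -> energy (fun i => Y i x t) = 0.
Proof.
move=> y0; have y1 : energy (fun i => Y i x t0) = 0.
  apply: (@linear_system_zero I (fun i j s => A i j s t0)
    (fun i s => Y i s t0) x0) => //.
  move=> s; exact: is_derive_continuous (Ck_dx s t0 (smooth_bound smooth_A 1)).
apply: (@linear_system_zero I (fun i j s => B i j x s)
  (fun i s => Y i x s) t0) => //.
move=> s; exact: is_derive_continuous (Ck_dt x s (smooth_bound smooth_B 1)).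
Qed.

(* On a box around (x0, t0), Gronwall in x bounds Y by its values on the line *)
(* x = x0; hence Y is Lipschitz in x there, uniformly in t.                   *)
Lemma plane_system_continuous i : continuous (fun p : R * R => Y i p.1 p.2).
Proof.
move=> [x0 t0].
(* The excess 1 is the tolerance with which continuity of [coef_bound] at (x0, t0) is used, so that
   K is a bound on a whole box. *)
set K := coef_bound (fun i j => A i j x0 t0) + 1.
have [d d0 HK] : exists2 d, 0 < d & forall x t, `|x0 - x| < d -> `|t0 - t| < d ->
    coef_bound (fun i j => A i j x t) <= K.
  have cb := Ck_continuous (smooth_bound smooth_A 0).
  have := cb (x0, t0) => /cvgrPdist_le /(_ _ ltr01) /nbhs_ballP[d /= d0 Hd].
  exists d => // x t hx ht; have /= := Hd (x, t) (conj hx ht).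
  by rewrite ler_distlC => /andP[]; rewrite /K; lra.
have K0 : 0 <= K.
  rewrite addr_ge0 // (le_trans _ (coef_bound_ge_all _)) //.
  by do 2![apply: sumr_ge0 => ? _].
set E0 := energy (fun i => Y i x0 t0).
(* E0 + 1 bounds the energy on the line x = x0 for t near t0; the exponential is the Gronwall factor
   over a distance d in x. *)
set M := (E0 + 1) * expR (2 * K * d).
have M0 : 0 <= M by rewrite mulr_ge0 ?expR_ge0 // addr_ge0 ?energy_ge0.
(* A Lipschitz constant in x: |Y_j| <= 1 + Y_j^2 <= 1 + M, and K bounds each row of A. The final 1
   makes L positive, since the radius below divides by it. *)
set L := K * (1 + M) + 1.
have L0 : 0 < L by rewrite ltr_wpDl // mulr_ge0 // addr_ge0.
apply/cvgrPdist_le => e e0.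
have Yt : \forall t \near t0, `|Y i x0 t0 - Y i x0 t| <= e / 2.
  by have /cvgrPdist_le := is_derive_continuous (Y_t i x0 t0); apply; rewrite divr_gt0.
have Et : \forall t \near t0, energy (fun i => Y i x0 t) <= E0 + 1.
  have : {for t0, continuous (fun t => energy (fun i => Y i x0 t))}.
    apply: is_derive_continuous.
    exact: (is_derive_fsum (fun j => is_deriveM (Y_t j x0 t0) (Y_t j x0 t0))).
  move=> /cvgrPdist_le /(_ _ ltr01); apply: filterS => t.
  by rewrite ler_distlC => /andP[].
have : nbhs t0 [set t | `|Y i x0 t0 - Y i x0 t| <= e / 2 /\
    energy (fun i => Y i x0 t) <= E0 + 1] by exact: filterI.
move=> /nbhs_ballP[d' /= d'0 Hd'].
apply/(@nbhs_ballP _ (R * R)%type (x0, t0)).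
exists (Num.min d (Num.min d' (e / 2 / L))).
  by rewrite /= !lt_min d0 d'0 !divr_gt0.
move=> [x t] [/= hx ht]; move: hx ht; rewrite /ball /= !lt_min.
move=> /and3P[xd xd' xe] /and3P[td td' te].
have [Yt' Et'] := Hd' t td'.
have En c : `|c - x0| <= `|x - x0| -> energy (fun i => Y i c t) <= M.
  move=> hc; have hcd : `|c - x0| < d by rewrite (le_lt_trans hc) // distrC.
  apply: (@le_trans _ _ (energy (fun i => Y i x0 t) * expR (2 * K * `|c - x0|))).
    apply: (@energy_growth I (fun i j s => A i j s t)
      (fun i s => Y i s t)) => // s hs.
    by apply: HK => //; rewrite distrC (le_lt_trans hs).
  rewrite ler_pM ?energy_ge0 ?expR_ge0 // ler_expR ler_wpM2l ?mulr_ge0 //.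
  exact: ltW.
have [c hc /= Ec] := @MVT_ball (Y i ^~ t) _ x0 x (fun s _ => Y_x i s t).
have dY : `|Y i x t - Y i x0 t| <= e / 2.
  rewrite Ec normrM; apply: (@le_trans _ _ (L * `|x - x0|)); last first.
    by rewrite mulrC -ler_pdivlMr // distrC ltW.
  rewrite ler_wpM2r // (@le_trans _ _ (K * (1 + M))) //; last by rewrite lerDl.
  apply: le_trans (ler_norm_sum _ _ _) _.
  apply: (@le_trans _ _ ((\sum_j `|A i j c t|) * (1 + M))).
    rewrite mulr_suml; apply: ler_sum => j _; rewrite normrM ler_wpM2l //.
    apply: le_trans (ler_norm_sqr _) _; rewrite lerD2l.
    exact: le_trans (energy_ge (fun i => Y i c t) j) (En _ hc).
  rewrite ler_wpM2r ?addr_ge0 //.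
  rewrite (le_trans (coef_bound_ge (fun i j => A i j c t) i)) // HK //.
  by rewrite distrC (le_lt_trans hc) // distrC.
rewrite [e]splitr -(subrKA (Y i x0 t)) (le_trans (ler_normD _ _)) // lerD //.
by rewrite distrC.
Qed.

(** Bootstrap: the partial derivatives of Y are combinations of the Y_j with smooth coefficients, so
    if all coordinates are of class C^n they are of class C^(n+1). *)
Lemma plane_system_smooth i : smooth (Y i).
Proof.
move=> n; elim: n i => [|n IH] i.
  by split=> //; apply: plane_system_continuous.
apply: (@CkS _ _ _ _ _ _ (@plane_system_continuous i) (Y_x i) (Y_t i)).
  by apply: Ck_sum => j; apply: CkM => //; apply: smooth_A.
by apply: Ck_sum => j; apply: CkM => //; apply: smooth_B.
Qed.

End plane.
End linear_systems.

(** * Complex linear systems and the Lax pair *)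

Section complex_systems.
Context {R : realType}.
Implicit Types (f g : R -> R -> R[i]) (z : R[i]).

Definition smoothC f :=
  smooth (fun x t => complex.Re (f x t)) /\
  smooth (fun x t => complex.Im (f x t)).

Lemma complex_eta z : z = Complex (complex.Re z) (complex.Im z).
Proof. by case: z. Qed.

Lemma ReD z1 z2 : complex.Re (z1 + z2) = complex.Re z1 + complex.Re z2.
Proof. by case: z1 z2 => ? ? []. Qed.

Lemma ImD z1 z2 : complex.Im (z1 + z2) = complex.Im z1 + complex.Im z2.
Proof. by case: z1 z2 => ? ? []. Qed.

Lemma ReM z1 z2 : complex.Re (z1 * z2) =
  complex.Re z1 * complex.Re z2 - complex.Im z1 * complex.Im z2.
Proof. by case: z1 z2 => ? ? []. Qed.

Lemma ImM z1 z2 : complex.Im (z1 * z2) =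
  complex.Re z1 * complex.Im z2 + complex.Im z1 * complex.Re z2.
Proof. by case: z1 z2 => ? ? []. Qed.

Lemma ReN z : complex.Re (- z) = - complex.Re z.
Proof. by case: z. Qed.

Lemma ImN z : complex.Im (- z) = - complex.Im z.
Proof. by case: z. Qed.

Lemma Re_conj z : complex.Re z^* = complex.Re z.
Proof. by case: z. Qed.

Lemma Im_conj z : complex.Im z^* = - complex.Im z.
Proof. by case: z. Qed.

Lemma Re_i : complex.Re ('i : R[i]) = 0.
Proof. by rewrite -complexiE. Qed.

Lemma Im_i : complex.Im ('i : R[i]) = 1.
Proof. by rewrite -complexiE. Qed.

Lemma half_complex : (2^-1 : R[i]) = Complex 2^-1 0.
Proof. by rewrite -[RHS]/((2^-1)%:C)%C fmorphV rmorph_nat. Qed.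

Lemma Re_half : complex.Re (2^-1 : R[i]) = 2^-1.
Proof. by rewrite half_complex. Qed.

Lemma Im_half : complex.Im (2^-1 : R[i]) = 0.
Proof. by rewrite half_complex. Qed.

Lemma sqr_norm_conj z : `|z| ^+ 2 = z * z^*.
Proof. exact: sqr_normc. Qed.

Definition ReImE := (ReD, ImD, ReM, ImM, ReN, ImN, Re_conj, Im_conj, Re_i, Im_i,
  Re_half, Im_half).

Lemma smoothC_cst z : smoothC (fun _ _ => z).
Proof. by split=> n; exact: Ck_cst. Qed.

Lemma smoothCD f g : smoothC f -> smoothC g -> smoothC (fun x t => f x t + g x t).
Proof.
move=> [f1 f2] [g1 g2]; split=> n; under eq_fun do under eq_fun do rewrite ReImE.
  exact: CkD.
exact: CkD.
Qed.

Lemma smoothCM f g : smoothC f -> smoothC g -> smoothC (fun x t => f x t * g x t).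
Proof.
move=> [f1 f2] [g1 g2]; split=> n; under eq_fun do under eq_fun do rewrite ReImE.
  by apply: CkB; exact: CkM.
by apply: CkD; exact: CkM.
Qed.

Lemma smoothCN f : smoothC f -> smoothC (fun x t => - f x t).
Proof.
move=> [f1 f2]; split=> n; under eq_fun do under eq_fun do rewrite ReImE;
exact: CkN.
Qed.

Lemma smoothC_conj f : smoothC f -> smoothC (fun x t => (f x t)^*).
Proof.
move=> [f1 f2]; split=> n; under eq_fun do under eq_fun do rewrite ReImE.
  exact: f1.
exact: CkN.
Qed.

Lemma smooth_dx (V : normedModType R) (f : R -> R -> V) : smooth f -> smooth (dx f).
Proof. by move=> F n; case: (F n.+1) => _ []. Qed.

Lemma smoothC_dxC f : smoothC f -> smoothC (dxC f).
Proof. by move=> [f1 f2]; split; exact: smooth_dx. Qed.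

Section system.
Variables (n : nat) (M L : R -> R -> 'M[R[i]]_n) (y : R -> R -> 'cV[R[i]]_n).
Hypothesis smooth_M : forall i j, smoothC (fun x t => M x t i j).
Hypothesis smooth_L : forall i j, smoothC (fun x t => L x t i j).
Hypothesis y_x : forall x t, is_cvderive x (y ^~ t) (M x t *m y x t).
Hypothesis y_t : forall x t, is_cvderive t (y x) (L x t *m y x t).

(* The index (false, i) stands for the real part of the i-th coordinate and   *)
(* (true, i) for its imaginary part.                                          *)
Let realify (A : 'M[R[i]]_n) (p q : bool * 'I_n) : R :=
  if p.1 == q.1 then complex.Re (A p.2 q.2)
  else if p.1 then complex.Im (A p.2 q.2) else - complex.Im (A p.2 q.2).

Let part (v : 'cV[R[i]]_n) (p : bool * 'I_n) : R :=
  if p.1 then complex.Im (v p.2 0) else complex.Re (v p.2 0).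

(** Multiplication by a complex entry is a real 2 x 2 block, which turns the complex system into a
    real one of twice the size. *)
Let part_mulmx A v p : part (A *m v) p = \sum_q realify A p q * part v q.
Proof.
rewrite -(pair_bigA _ (fun b j => realify A p (b, j) * part v (b, j))) big_bool.
rewrite /realify /part /=; case: p => [[] i] /=; rewrite mxE -big_split /=.
  rewrite (big_morph _ ImD (erefl : complex.Im (0 : R[i]) = 0)).
  by apply: eq_bigr => j _; rewrite ImM.
rewrite (big_morph _ ReD (erefl : complex.Re (0 : R[i]) = 0)).
by apply: eq_bigr => j _; rewrite ReM mulNr addrC.
Qed.

Let smooth_realify (A : R -> R -> 'M[R[i]]_n) p q :
  (forall i j, smoothC (fun x t => A x t i j)) ->
  smooth (fun x t => realify (A x t) p q).
Proof.
move=> HA; have [Hr Hi] := HA p.2 q.2; rewrite /realify.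
by case: (p.1 == q.1) => //; case: (p.1) => // m; exact: CkN.
Qed.

Let part_x p (x t : R) : is_derive x 1 (fun s => part (y s t) p)
  (\sum_q realify (M x t) p q * part (y x t) q).
Proof. by rewrite -part_mulmx /part; case: p => [[] i] /=; have [] := y_x x t i. Qed.

Let part_t p (x t : R) : is_derive t 1 (fun s => part (y x s) p)
  (\sum_q realify (L x t) p q * part (y x t) q).
Proof. by rewrite -part_mulmx /part; case: p => [[] i] /=; have [] := y_t x t i. Qed.

Let HM p q := @smooth_realify M p q smooth_M.
Let HL p q := @smooth_realify L p q smooth_L.

Lemma complex_system_smooth i : smoothC (fun x t => y x t i 0).
Proof.
split.
  exact: (plane_system_smooth HM HL part_x part_t (false, i)).
exact: (plane_system_smooth HM HL part_x part_t (true, i)).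
Qed.

(** By contraposition: a zero at (x, t) would propagate back to (x0, t0). *)
Lemma complex_system_neq0 x0 t0 x t : y x0 t0 != 0 -> y x t != 0.
Proof.
apply: contra => /eqP y0; apply/eqP/matrixP => i j; rewrite ord1 mxE.
have e0 : energy (part (y x t)) = 0.
  by apply: big1 => -[[] k] _; rewrite /part y0 mxE /= mulr0.
have /energy_eq0 e := plane_system_zero HM HL part_x part_t x0 t0 e0.
have er : complex.Re (y x0 t0 i 0) = 0 := e (false, i).
have ei : complex.Im (y x0 t0 i 0) = 0 := e (true, i).
by rewrite [y x0 t0 i 0]complex_eta er ei.
Qed.

End system.
End complex_systems.

(** * The Lax pair as a linear system with smooth coefficients *)

Section lax.
Context {R : realType}.
Variables (alpha : R[i]) (k1 k2 : R -> R -> R) (y : R -> R -> 'cV[R[i]]_2).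
Hypothesis k1_smooth : smooth k1.
Hypothesis k2_smooth : smooth k2.
Hypothesis y_sol : lax_solution alpha (q_of k1 k2) y.
Let q := q_of k1 k2.

Lemma q_ofE x t : q_of k1 k2 x t = Complex (k1 x t / 2) (k2 x t / 2).
Proof.
by rewrite [LHS]complex_eta /q_of !ReImE /=; congr Complex; ring.
Qed.

Lemma dxC_qE x t : dxC (q_of k1 k2) x t = Complex (dx k1 x t / 2) (dx k2 x t / 2).
Proof.
have H (k : R -> R -> R) (k_smooth : smooth k) :
    dx (fun x t => k x t / 2) x t = dx k x t / 2.
  have h := is_deriveM (Ck_dx x t (k_smooth 1%N)) (is_derive_cst (2^-1 : R) x 1).
  apply: dxE; apply: (is_derive_eq h).
  by rewrite /GRing.scale /= mulr0 add0r mulrC.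
have qr : (fun x t => complex.Re (q_of k1 k2 x t)) = fun x t => k1 x t / 2.
  by apply/funext => u; apply/funext => v; rewrite q_ofE.
have qi : (fun x t => complex.Im (q_of k1 k2 x t)) = fun x t => k2 x t / 2.
  by apply/funext => u; apply/funext => v; rewrite q_ofE.
by rewrite /dxC qr qi (H _ k1_smooth) (H _ k2_smooth).
Qed.

Lemma dxC_conj (f : R -> R -> R[i]) x t :
  derivable (fun s => complex.Im (f s t)) x 1 ->
  dxC (fun x t => (f x t)^*) x t = (dxC f x t)^*.
Proof.
move=> /derivableP Hf.
have fr : (fun x t => complex.Re (f x t)^*) = fun x t => complex.Re (f x t).
  by apply/funext => u; apply/funext => v; rewrite Re_conj.
have fi : (fun x t => complex.Im (f x t)^*) = fun x t => - complex.Im (f x t).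
  by apply/funext => u; apply/funext => v; rewrite Im_conj.
rewrite /dxC fr fi -[RHS]/(Complex _ (- _)); congr Complex.
by apply: dxE; rewrite /dx derive1E; exact: is_deriveN.
Qed.

Lemma smoothC_q : smoothC q.
Proof.
split=> n; rewrite /q; under eq_fun do under eq_fun do rewrite q_ofE /=;
by apply: CkM; [|exact: Ck_cst].
Qed.

Lemma smoothC_lax_x i j : smoothC (fun x t => lax_x alpha q x t i j).
Proof.
have Hq := smoothC_q.
case: i => -[|[|//]] ?; case: j => -[|[|//]] ?;
  under eq_fun do under eq_fun do rewrite mxE /=.
- exact: smoothC_cst.
- exact: smoothCN.
- exact: smoothC_conj.
- exact: smoothC_cst.
Qed.

Lemma smoothC_lax_t i j : smoothC (fun x t => lax_t alpha q x t i j).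
Proof.
have Hq := smoothC_q; have Hqc := smoothC_conj Hq.
have cst := smoothC_cst.
have Hn : smoothC (fun x t => `|q x t| ^+ 2).
  under eq_fun do under eq_fun do rewrite sqr_norm_conj.
  exact: smoothCM.
case: i => -[|[|//]] ?; case: j => -[|[|//]] ?;
  under eq_fun do under eq_fun do rewrite mxE /=.
- by apply: smoothCD => //; apply: smoothCM.
- apply: smoothCD; first exact: smoothCM.
  by apply: smoothCN; apply: smoothCM => //; apply: smoothC_dxC.
- apply: smoothCD; first exact: smoothCM.
  by apply: smoothCN; apply: smoothCM => //; apply: smoothC_dxC.
- by apply: smoothCD => //; apply: smoothCN; apply: smoothCM.
Qed.

Lemma lax_solution_smooth i : smoothC (fun x t => y x t i 0).
Proof.
apply: (complex_system_smooth smoothC_lax_x smoothC_lax_t) => x t.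
  by case: (y_sol x t).
by case: (y_sol x t).
Qed.

Lemma lax_solution_neq0 x0 t0 x t : y x0 t0 != 0 -> y x t != 0.
Proof.
apply: (complex_system_neq0 smoothC_lax_x smoothC_lax_t) => u v.
  by case: (y_sol u v).
by case: (y_sol u v).
Qed.

End lax.

(** * Cross products and rotations *)

Lemma sum3 (V : nmodType) (F : 'I_3 -> V) : \sum_i F i = F 0 + F 1 + F 2.
Proof.
rewrite !big_ord_recl big_ord0 addr0 addrA.
by congr (_ + F _ + F _); apply: val_inj.
Qed.

Lemma mulmx2 (T : pzSemiRingType) (A : 'M[T]_2) (v : 'cV[T]_2) i :
  (A *m v) i 0 = A i 0 * v 0 0 + A i 1 * v 1 0.
Proof.
rewrite mxE !big_ord_recl big_ord0 addr0.
by congr (_ + A i _ * v _ 0); apply: val_inj.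
Qed.

Lemma ord3P (P : 'I_3 -> Prop) : P 0 -> P 1 -> P 2 -> forall i, P i.
Proof.
move=> P0 P1 P2 [[|[|[|//]]] hi].
- by rewrite (_ : Ordinal hi = 0) //; apply: val_inj.
- by rewrite (_ : Ordinal hi = 1) //; apply: val_inj.
- by rewrite (_ : Ordinal hi = 2) //; apply: val_inj.
Qed.

Lemma det_mx3 (T : comPzRingType) (A : 'M[T]_3) : \det A =
  A 0 0 * (A 1 1 * A 2 2 - A 1 2 * A 2 1)
  - A 0 1 * (A 1 0 * A 2 2 - A 1 2 * A 2 0)
  + A 0 2 * (A 1 0 * A 2 1 - A 1 1 * A 2 0).
Proof.
rewrite (expand_det_row _ 0) sum3 /cofactor /=.
have det2 (B : 'M[T]_2) : \det B = B 0 0 * B 1 1 - B 0 1 * B 1 0.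
  rewrite (expand_det_row _ 0) !big_ord_recl big_ord0 addr0 /cofactor.
  rewrite !det_mx11 !mxE /=.
  rewrite (_ : lift ord0 ord0 = 1); last exact: val_inj.
  rewrite (_ : lift (1 : 'I_2) (0 : 'I_1) = 0); last exact: val_inj.
  by rewrite !addn0 addn1 expr0 expr1 mul1r mulN1r mulrN.
rewrite !det2 !mxE.
have l00 : lift (0 : 'I_3) (0 : 'I_2) = 1 by apply: val_inj.
have l01 : lift (0 : 'I_3) (1 : 'I_2) = 2 by apply: val_inj.
have l10 : lift (1 : 'I_3) (0 : 'I_2) = 0 by apply: val_inj.
have l11 : lift (1 : 'I_3) (1 : 'I_2) = 2 by apply: val_inj.
have l20 : lift (2 : 'I_3) (0 : 'I_2) = 0 by apply: val_inj.
have l21 : lift (2 : 'I_3) (1 : 'I_2) = 1 by apply: val_inj.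
rewrite l00 l01 l10 l11 l20 l21 /= ?add0n expr0 expr1.
have -> : (-1 : T) ^+ 2 = 1 by rewrite sqrrN expr1n.
by ring.
Qed.

Section frame_algebra.
Context {R : realType}.

Definition col3 (a b c : R) : 'cV[R]_3 :=
  mx_of_rows 3 1 [:: [:: a]; [:: b]; [:: c]].

Lemma col3P (v w : 'cV[R]_3) :
  v 0 0 = w 0 0 -> v 1 0 = w 1 0 -> v 2 0 = w 2 0 -> v = w.
Proof.
by move=> *; apply/matrixP => i j; rewrite ord1; move: i; apply: ord3P.
Qed.

Lemma cross_mulmx (g : 'M[R]_3) (u v : 'cV[R]_3) : SO3 g ->
  cross (g *m u) (g *m v) = g *m cross u v.
Proof.
move=> [gg dg]; have ggT : g *m g^T = 1%:M by exact: mulmx1C.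
(* g^T (g u x g v) = det g (u x v) holds for every 3 x 3 matrix g. *)
rewrite -[LHS]mul1mx -ggT -mulmxA; congr (_ *m _).
rewrite -[RHS]scale1r -dg det_mx3.
apply: col3P; rewrite !mxE !sum3 /=; do ?rewrite ?mxE ?sum3 /=; ring.
Qed.

End frame_algebra.

(** * The Hopf image of a solution of the Lax system *)

Section hopf.
Context {R : realType}.
Implicit Types z w : R[i].

Definition is_derC (s : R) (f : R -> R[i]) (df : R[i]) :=
  is_derive s 1 (fun r => complex.Re (f r)) (complex.Re df) /\
  is_derive s 1 (fun r => complex.Im (f r)) (complex.Im df).

Lemma is_derC_mul_conj (s : R) (f g : R -> R[i]) df dg :
  is_derC s f df -> is_derC s g dg ->
  is_derC s (fun r => f r * (g r)^*) (df * (g s)^* + f s * dg^*).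
Proof.
move=> [f1 f2] [g1 g2].
have g2' : is_derive s 1 (fun r => - complex.Im (g r)) (- complex.Im dg).
  exact: is_deriveN.
split; under eq_fun do rewrite !ReImE.
  apply: (is_derive_eq (is_deriveB (is_deriveM f1 g1) (is_deriveM f2 g2'))).
  by rewrite !ReImE /GRing.scale /=; ring.
apply: (is_derive_eq (is_deriveD (is_deriveM f1 g2') (is_deriveM f2 g1))).
by rewrite !ReImE /GRing.scale /=; ring.
Qed.

(* For y = (z0, z1): |z1|^2 - |z0|^2, 2 Re and 2 Im of z0 conj(z1), and |y|^2. *)
Definition hopfU (v : 'cV[R[i]]_2) : R :=
  complex.Re (v 1 0 * (v 1 0)^*) - complex.Re (v 0 0 * (v 0 0)^*).
Definition hopfV (v : 'cV[R[i]]_2) : R := 2 * complex.Re (v 0 0 * (v 1 0)^*).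
Definition hopfW (v : 'cV[R[i]]_2) : R := 2 * complex.Im (v 0 0 * (v 1 0)^*).
Definition hopfN (v : 'cV[R[i]]_2) : R :=
  complex.Re (v 1 0 * (v 1 0)^*) + complex.Re (v 0 0 * (v 0 0)^*).

(** The Hopf map to the unit sphere. It is unchanged when a nonzero v is multiplied by a nonzero
    complex scalar, so only the complex line of v matters. *)
Definition hopf v : 'cV[R]_3 :=
  col3 (hopfU v / hopfN v) (hopfV v / hopfN v) (hopfW v / hopfN v).

(** (|z1|^2 - |z0|^2)^2 + 4 |z0|^2 |z1|^2 = (|z1|^2 + |z0|^2)^2. *)
Lemma hopf_sphere v :
  hopfU v ^+ 2 + hopfV v ^+ 2 + hopfW v ^+ 2 = hopfN v ^+ 2.
Proof. by rewrite /hopfU /hopfV /hopfW /hopfN !ReImE; ring. Qed.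

Lemma hopfN_neq0 v : v != 0 -> hopfN v != 0.
Proof.
apply: contra => /eqP; rewrite /hopfN !ReImE => e0.
have {e0} [e1 e2 e3 e4] : [/\ complex.Re (v 0 0) = 0, complex.Im (v 0 0) = 0,
    complex.Re (v 1 0) = 0 & complex.Im (v 1 0) = 0] by split; nra.
apply/eqP/matrixP => i j; rewrite ord1 mxE {j}.
have v0 : v 0 0 = 0 by rewrite [LHS]complex_eta e1 e2.
have v1 : v 1 0 = 0 by rewrite [LHS]complex_eta e3 e4.
by case: i => -[|[|//]] hi; [rewrite -[RHS]v0|rewrite -[RHS]v1];
  congr (v _ 0); apply: val_inj.
Qed.

Section der.
Variables (s : R) (v : R -> 'cV[R[i]]_2) (dv : 'cV[R[i]]_2).
Hypothesis Hv : is_cvderive s v dv.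

Let D i j : is_derC s (fun r => v r i 0 * (v r j 0)^*)
  (dv i 0 * (v s j 0)^* + v s i 0 * (dv j 0)^*).
Proof. by apply: is_derC_mul_conj; apply: Hv. Qed.

Lemma is_derive_hopfU : is_derive s 1 (fun r => hopfU (v r))
  (2 * (complex.Re (dv 1 0 * (v s 1 0)^*) - complex.Re (dv 0 0 * (v s 0 0)^*))).
Proof.
apply: (is_derive_eq (is_deriveB (D 1 1).1 (D 0 0).1)).
by rewrite !ReImE; ring.
Qed.

Lemma is_derive_hopfN : is_derive s 1 (fun r => hopfN (v r))
  (2 * (complex.Re (dv 1 0 * (v s 1 0)^*) + complex.Re (dv 0 0 * (v s 0 0)^*))).
Proof.
apply: (is_derive_eq (is_deriveD (D 1 1).1 (D 0 0).1)).
by rewrite !ReImE; ring.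
Qed.

Lemma is_derive_hopfV : is_derive s 1 (fun r => hopfV (v r))
  (2 * complex.Re (dv 0 0 * (v s 1 0)^* + v s 0 0 * (dv 1 0)^*)).
Proof. exact: (is_deriveZ 2 (D 0 1).1). Qed.

Lemma is_derive_hopfW : is_derive s 1 (fun r => hopfW (v r))
  (2 * complex.Im (dv 0 0 * (v s 1 0)^* + v s 0 0 * (dv 1 0)^*)).
Proof. exact: (is_deriveZ 2 (D 0 1).2). Qed.

End der.

(** The quotient rule is arranged around f/g and the logarithmic derivative of g, so that the
    derivative of a normalized coordinate is again expressed by normalized coordinates. *)
Lemma is_derive_quot (f g : R -> R) (s df dg : R) : g s != 0 ->
  is_derive s 1 f df -> is_derive s 1 g dg ->
  is_derive s 1 (fun r => f r / g r) (df / g s - f s / g s * (dg / g s)).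
Proof.
move=> g0 Hf Hg; apply: (is_derive_eq (is_deriveM Hf (is_deriveV g0 Hg))).
by rewrite /GRing.scale /=; field.
Qed.

End hopf.

(** * Evolution of the Hopf image under the Lax pair *)

Section lax_hopf.
Context {R : realType}.
Variables (alpha : R[i]) (k1 k2 : R -> R -> R) (y : R -> R -> 'cV[R[i]]_2).
Hypothesis k1_smooth : smooth k1.
Hypothesis k2_smooth : smooth k2.
Hypothesis y_sol : lax_solution alpha (q_of k1 k2) y.
Hypothesis y_neq0 : forall x t, y x t != 0.
Let a := complex.Re alpha.
Let b := complex.Im alpha.
Let u x t := hopf (y x t) 0 0.
Let v x t := hopf (y x t) 1 0.
Let w x t := hopf (y x t) 2 0.

Let uE x t : u x t = hopfU (y x t) / hopfN (y x t).
Proof. by rewrite /u mxE. Qed.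

Let vE x t : v x t = hopfV (y x t) / hopfN (y x t).
Proof. by rewrite /v mxE. Qed.

Let wE x t : w x t = hopfW (y x t) / hopfN (y x t).
Proof. by rewrite /w mxE. Qed.

Lemma hopf_unit x t : u x t ^+ 2 + v x t ^+ 2 + w x t ^+ 2 = 1.
Proof.
have N0 := hopfN_neq0 (y_neq0 x t).
by rewrite uE vE wE !expr_div_n -!mulrDl hopf_sphere divff // expf_neq0.
Qed.

Let dquot (r : R) (z : R -> 'cV[R[i]]_2) dz (h : 'cV[R[i]]_2 -> R) dh :
  z r != 0 -> is_cvderive r z dz -> is_derive r 1 (fun s => h (z s)) dh ->
  is_derive r 1 (fun s => h (z s) / hopfN (z s))
   (dh / hopfN (z r) - h (z r) / hopfN (z r) *
   (2 * (complex.Re (dz 1 0 * (z r 1 0)^*) +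
         complex.Re (dz 0 0 * (z r 0 0)^*)) / hopfN (z r))).
Proof.
move=> /hopfN_neq0 N0 Hz Hh.
exact: (@is_derive_quot _ (fun s => h (z s)) (fun s => hopfN (z s)) r _ _ N0 Hh
  (is_derive_hopfN Hz)).
Qed.

Let dxC_qbarE x t :
  dxC (fun x t => (q_of k1 k2 x t)^*) x t = (dxC (q_of k1 k2) x t)^*.
Proof.
apply: dxC_conj; under eq_fun do rewrite q_ofE /=.
by apply: (@derivableM _ _ (k2^~ t)) => //; have [] := Ck_dx x t (k2_smooth 1%N).
Qed.

Lemma lax_x_mulmx x t (z : 'cV[R[i]]_2) :
  (lax_x alpha (q_of k1 k2) x t *m z) 0 0 = Complex
     (b * complex.Re (z 0 0) + a * complex.Im (z 0 0)
      - (k1 x t * complex.Re (z 1 0) - k2 x t * complex.Im (z 1 0)) / 2)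
     (b * complex.Im (z 0 0) - a * complex.Re (z 0 0)
      - (k1 x t * complex.Im (z 1 0) + k2 x t * complex.Re (z 1 0)) / 2) /\
  (lax_x alpha (q_of k1 k2) x t *m z) 1 0 = Complex
     ((k1 x t * complex.Re (z 0 0) + k2 x t * complex.Im (z 0 0)) / 2
      - b * complex.Re (z 1 0) - a * complex.Im (z 1 0))
     ((k1 x t * complex.Im (z 0 0) - k2 x t * complex.Re (z 0 0)) / 2
      - b * complex.Im (z 1 0) + a * complex.Re (z 1 0)).
Proof.
by split; rewrite [LHS]complex_eta mulmx2 !mxE /= q_ofE !ReImE /=;
  congr Complex; field.
Qed.

(** The abbreviations stand for r1 + i r2 = alpha q, s1 + i s2 = alpha conj(q), and 2ab - i d for
    the upper left entry of the Lax matrix. *)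
Lemma lax_t_mulmx x t (z : 'cV[R[i]]_2) :
  let p1 := dx k1 x t in let p2 := dx k2 x t in
  let d := a ^+ 2 - b ^+ 2 - (k1 x t ^+ 2 + k2 x t ^+ 2) / 8 in
  let r1 := (a * k1 x t - b * k2 x t) / 2 in
  let r2 := (a * k2 x t + b * k1 x t) / 2 in
  let s1 := (a * k1 x t + b * k2 x t) / 2 in
  let s2 := (b * k1 x t - a * k2 x t) / 2 in
  (lax_t alpha (q_of k1 k2) x t *m z) 0 0 = Complex
     (2 * a * b * complex.Re (z 0 0) + d * complex.Im (z 0 0)
      - (r1 - p2 / 4) * complex.Re (z 1 0) + (r2 + p1 / 4) * complex.Im (z 1 0))
     (2 * a * b * complex.Im (z 0 0) - d * complex.Re (z 0 0)
      - (r1 - p2 / 4) * complex.Im (z 1 0) - (r2 + p1 / 4) * complex.Re (z 1 0)) /\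
  (lax_t alpha (q_of k1 k2) x t *m z) 1 0 = Complex
     ((s1 - p2 / 4) * complex.Re (z 0 0) - (s2 - p1 / 4) * complex.Im (z 0 0)
      - 2 * a * b * complex.Re (z 1 0) - d * complex.Im (z 1 0))
     ((s1 - p2 / 4) * complex.Im (z 0 0) + (s2 - p1 / 4) * complex.Re (z 0 0)
      - 2 * a * b * complex.Im (z 1 0) + d * complex.Re (z 1 0)).
Proof.
move=> p1 p2 d r1 r2 s1 s2.
have entry i j p r : complex.Re (lax_t alpha (q_of k1 k2) x t i j) = p ->
    complex.Im (lax_t alpha (q_of k1 k2) x t i j) = r ->
    lax_t alpha (q_of k1 k2) x t i j = Complex p r.
  by move=> <- <-; exact: complex_eta.
have e00 : lax_t alpha (q_of k1 k2) x t 0 0 = Complex (2 * a * b) (- d).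
  by apply: entry; rewrite mxE /= sqr_norm_conj q_ofE expr2 !ReImE /= -/a -/b /d;
    field.
have e01 : lax_t alpha (q_of k1 k2) x t 0 1 = Complex (- r1 + p2 / 4) (- r2 - p1 / 4).
  by apply: entry; rewrite mxE /= dxC_qE // q_ofE !ReImE /=
    -/a -/b /r1 /r2 /p1 /p2; field.
have e10 : lax_t alpha (q_of k1 k2) x t 1 0 = Complex (s1 - p2 / 4) (s2 - p1 / 4).
  by apply: entry; rewrite mxE /= dxC_qbarE dxC_qE // q_ofE !ReImE /=
    -/a -/b /s1 /s2 /p1 /p2; field.
have e11 : lax_t alpha (q_of k1 k2) x t 1 1 = Complex (- (2 * a * b)) d.
  by apply: entry; rewrite mxE /= sqr_norm_conj q_ofE expr2 !ReImE /= -/a -/b /d;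
    field.
by split; rewrite [LHS]complex_eta mulmx2 ?(e00, e01, e10, e11) !ReImE /=;
  congr Complex; ring.
Qed.

Lemma is_derive_hopf_x (x t : R) : is_derive x 1 (fun s => hopf (y s t))
  (col3 (k1 x t * v x t + k2 x t * w x t - 2 * b * (1 - u x t ^+ 2))
        (2 * a * w x t - k1 x t * u x t + 2 * b * u x t * v x t)
        (- 2 * a * v x t - k2 x t * u x t + 2 * b * u x t * w x t)).
Proof.
have N0 := hopfN_neq0 (y_neq0 x t).
have [Hy _] := y_sol x t;
  have [E0 E1] := lax_x_mulmx x t (y x t); have y0 := y_neq0 x t.
(* The derivative of |y|^2: only the Hermitian part diag(b, -b) of the Lax matrix contributes. *)
have EN :
    2 * (complex.Re ((lax_x alpha (q_of k1 k2) x t *m y x t) 1 0 * (y x t 1 0)^*)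
    + complex.Re ((lax_x alpha (q_of k1 k2) x t *m y x t) 0 0 * (y x t 0 0)^*))
    = - 2 * b * hopfU (y x t).
  by rewrite /hopfU ?E0 ?E1 !ReImE /=; field.
apply/is_derive_mxP => i j; rewrite ord1 {j}; move: i.
apply: ord3P; under eq_fun do rewrite mxE /=; rewrite mxE /= uE vE wE.
- apply: (is_derive_eq (dquot y0 Hy (is_derive_hopfU Hy))); rewrite EN.
  rewrite (_ : 2 * (complex.Re _ - _) = k1 x t * hopfV (y x t) + k2 x t * hopfW (y x t)
    - 2 * b * hopfN (y x t));
    first by field.
  by rewrite /hopfV /hopfW /hopfN ?E0 ?E1 !ReImE /=; field.
- apply: (is_derive_eq (dquot y0 Hy (is_derive_hopfV Hy))); rewrite EN.
  rewrite (_ : 2 * complex.Re (_ + _) = 2 * a * hopfW (y x t) - k1 x t * hopfU (y x t));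
    first by field.
  by rewrite /hopfU /hopfW ?E0 ?E1 !ReImE /=; field.
- apply: (is_derive_eq (dquot y0 Hy (is_derive_hopfW Hy))); rewrite EN.
  rewrite (_ : 2 * complex.Im (_ + _) =
    - 2 * a * hopfV (y x t) - k2 x t * hopfU (y x t));
    first by field.
  by rewrite /hopfU /hopfV ?E0 ?E1 !ReImE /=; field.
Qed.

Let Q x t := (k1 x t ^+ 2 + k2 x t ^+ 2) / 4.

(** Here -m is the logarithmic t-derivative of |y|^2, so the terms with m come from the
    normalization; d is -2 times the d of [lax_t_mulmx]. The terms with Q, p1 and p2 are exactly
    those that the rotation of the frame will cancel. *)
Lemma is_derive_hopf_t (x t : R) : is_derive t 1 (fun s => hopf (y x s))
  (let p1 := dx k1 x t in let p2 := dx k2 x t in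
   let m := 4 * a * b * u x t + b * (k1 x t * w x t - k2 x t * v x t) in
   let d := Q x t - 2 * (a ^+ 2 - b ^+ 2) in
   col3
    (- 4 * a * b + a * (k1 x t * v x t + k2 x t * w x t)
       + (p1 * w x t - p2 * v x t) / 2 + u x t * m)
    (- d * w x t - (a * k1 x t - p2 / 2) * u x t + b * k2 x t + v x t * m)
    (d * v x t - (a * k2 x t + p1 / 2) * u x t - b * k1 x t + w x t * m)).
Proof.
have N0 := hopfN_neq0 (y_neq0 x t).
have [_ Hy] := y_sol x t;
  have [E0 E1] := lax_t_mulmx x t (y x t); have y0 := y_neq0 x t.
(* Again only the Hermitian part of the Lax matrix contributes; all its entries carry the factor
   b. *)
have EN :
    2 * (complex.Re ((lax_t alpha (q_of k1 k2) x t *m y x t) 1 0 * (y x t 1 0)^*)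
    + complex.Re ((lax_t alpha (q_of k1 k2) x t *m y x t) 0 0 * (y x t 0 0)^*))
    = - 4 * a * b * hopfU (y x t)
      - b * (k1 x t * hopfW (y x t) - k2 x t * hopfV (y x t)).
  rewrite /hopfU /hopfV /hopfW ?E0 ?E1.
  by rewrite !ReImE /=; field.
apply/is_derive_mxP => i j; rewrite ord1 {j}; move: i.
apply: ord3P; under eq_fun do rewrite mxE /=; rewrite mxE /= uE vE wE.
- apply: (is_derive_eq (dquot y0 Hy (is_derive_hopfU Hy))); rewrite EN.
  rewrite (_ : 2 * (complex.Re _ - _) = - 4 * a * b * hopfN (y x t)
    + a * (k1 x t * hopfV (y x t) + k2 x t * hopfW (y x t))
    + (dx k1 x t * hopfW (y x t) - dx k2 x t * hopfV (y x t)) / 2);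
    first by field.
  rewrite /hopfN /hopfV /hopfW ?E0 ?E1.
  by rewrite !ReImE /=; field.
- apply: (is_derive_eq (dquot y0 Hy (is_derive_hopfV Hy))); rewrite EN.
  rewrite (_ : 2 * complex.Re (_ + _) =
   - (Q x t - 2 * (a ^+ 2 - b ^+ 2)) * hopfW (y x t)
   - (a * k1 x t - dx k2 x t / 2) * hopfU (y x t) + b * k2 x t * hopfN (y x t));
    first by field.
  rewrite /Q /hopfN /hopfU /hopfW ?E0 ?E1.
  by rewrite !ReImE /=; field.
- apply: (is_derive_eq (dquot y0 Hy (is_derive_hopfW Hy))); rewrite EN.
  rewrite (_ : 2 * complex.Im (_ + _) =
   (Q x t - 2 * (a ^+ 2 - b ^+ 2)) * hopfV (y x t)
   - (a * k2 x t + dx k1 x t / 2) * hopfU (y x t) - b * k1 x t * hopfN (y x t));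
    first by field.
  rewrite /Q /hopfN /hopfU /hopfV ?E0 ?E1.
  by rewrite !ReImE /=; field.
Qed.

Lemma hopf_smooth : smooth (fun x t => hopf (y x t)).
Proof.
move=> n; have Hp i j : smoothC (fun x t => y x t i 0 * (y x t j 0)^*).
  by apply: smoothCM; [|apply: smoothC_conj];
    exact: (lax_solution_smooth k1_smooth k2_smooth y_sol).
have NV : Ck n (fun x t => (hopfN (y x t))^-1).
  apply: CkV; first by move=> x t; exact: hopfN_neq0.
  by apply: CkD; [exact: (Hp 1 1).1|exact: (Hp 0 0).1].
apply/Ck_mxP => i j; rewrite ord1; move: i; apply: ord3P;
  under eq_fun do under eq_fun do rewrite mxE /=; apply: CkM => //.
- by apply: CkB; [exact: (Hp 1 1).1|exact: (Hp 0 0).1].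
- by apply: CkM; [exact: Ck_cst|exact: (Hp 0 1).1].
- by apply: CkM; [exact: Ck_cst|exact: (Hp 0 1).2].
Qed.

End lax_hopf.

(** * The transformed curve *)

Section backlund.
Context {R : realType}.
Variables (gamma : R -> R -> 'cV[R]_3) (g : R -> R -> 'M[R]_3).
Variables (k1 k2 : R -> R -> R) (alpha : R[i]) (y : R -> R -> 'cV[R[i]]_2).
Let a := complex.Re alpha.
Let b := complex.Im alpha.
Let c := b / (a ^+ 2 + b ^+ 2).

Lemma normc_sqr (z : R[i]) : normc z ^+ 2 = complex.Re (z * z^*).
Proof.
case: z => p r; rewrite /normc sqr_sqrtr ?addr_ge0 ?sqr_ge0 //.
by rewrite !ReImE /= mulrN opprK -!expr2.
Qed.

(** As |alpha y|^2 = |alpha|^2 |y|^2, the factor |alpha|^2 goes into the constant c, and |y|^2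
    normalizes the Hopf vector. *)
Lemma gamma_tildeE x t : gamma_tilde gamma g alpha y x t =
  gamma x t + c *: (g x t *m hopf (y x t)).
Proof.
rewrite /gamma_tilde; congr (_ + _).
have cE : cnorm2 (alpha *: y x t) = (a ^+ 2 + b ^+ 2) * hopfN (y x t).
  rewrite /cnorm2 !mxE !normcM !exprMn !normc_sqr /hopfN !ReImE -/a -/b.
  by ring.
rewrite cE invfM mulrA -/c -scalerA; congr (_ *: _).
have V :
    complex.Re (y x t 0 0 * (y x t 1 0)^* + (y x t 0 0)^* * y x t 1 0) = hopfV (y x t).
  by rewrite /hopfV !ReImE; ring.
have W :
    complex.Re ('i^-1 * (y x t 0 0 * (y x t 1 0)^* - (y x t 0 0)^* * y x t 1 0)) =
      hopfW (y x t).
  by rewrite invCi /hopfW !ReImE; ring.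
rewrite V W !normc_sqr -/(hopfU _).
apply: col3P; rewrite !mxE !sum3 !mxE /=; ring.
Qed.

Hypothesis gamma_sol : vfe_solution gamma.
Hypothesis g_frame : adapted_pframe gamma g k1 k2.
Hypothesis alpha_nonreal : alpha \isn't Num.real.
Hypothesis y_sol : lax_solution alpha (q_of k1 k2) y.
Hypothesis y_neq0 : forall x t, y x t != 0.

Let g_smooth : smooth g. Proof. by case: g_frame. Qed.
Let g_SO3 x t : SO3 (g x t). Proof. by case: g_frame => _ + _ _ _; apply. Qed.
Let gamma_x x t : dx gamma x t = g x t *m delta_mx 0 0.
Proof. by case: g_frame => _ _ <- _ _; rewrite colE. Qed.

Let g_unit x t : g x t \in unitmx.
Proof. by rewrite unitmxE (g_SO3 x t).2 unitr1. Qed.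

Let invg x t : invmx (g x t) = (g x t)^T.
Proof.
have [gg _] := g_SO3 x t.
by rewrite -[LHS]mul1mx -gg -mulmxA mulmxV // mulmx1.
Qed.

Let Mx x t : 'M[R]_3 := mx_of_rows 3 3
  [:: [:: 0; - k1 x t; - k2 x t]; [:: k1 x t; 0; 0]; [:: k2 x t; 0; 0]].
Let Mt x t : 'M[R]_3 := mx_of_rows 3 3
  [:: [:: 0; dx k2 x t / 2; - (dx k1 x t / 2)];
      [:: - (dx k2 x t / 2); 0; (k1 x t ^+ 2 + k2 x t ^+ 2) / 4];
      [:: dx k1 x t / 2; - ((k1 x t ^+ 2 + k2 x t ^+ 2) / 4); 0]].

Let g_x (x t : R) : is_derive x 1 (g^~ t) (g x t *m Mx x t).
Proof.
have -> : g x t *m Mx x t = dx g x t.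
  by case: g_frame => _ _ _ H _; rewrite /Mx -H mulmxA mulmxV // mul1mx.
exact: (Ck_dx x t (g_smooth 1%N)).
Qed.

Let g_t (x t : R) : is_derive t 1 (g x) (g x t *m Mt x t).
Proof.
have -> : g x t *m Mt x t = dt g x t.
  by case: g_frame => _ _ _ _ H; rewrite /Mt -H mulmxA mulmxV // mul1mx.
exact: (Ck_dt x t (g_smooth 1%N)).
Qed.

(** Smoothness of the curvatures is inherited from the frame: they are entries of g^T g_x. *)
Let k_smooth i k :
  (forall x t, k x t = (invmx (g x t) *m dx g x t) i 0) -> smooth k.
Proof.
move=> kE n; rewrite (_ : k = fun x t => ((g x t)^T *m dx g x t) i 0).
  suff /Ck_mxP : Ck n (fun x t => (g x t)^T *m dx g x t) by apply.
  apply: Ck_mulmx; last exact: smooth_dx.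
  apply/Ck_mxP => p r; under eq_fun do under eq_fun do rewrite mxE.
  by move/Ck_mxP: (g_smooth n); apply.
by apply/funext => x; apply/funext => t; rewrite kE invg.
Qed.

Lemma frame_curvature_smooth : smooth k1 /\ smooth k2.
Proof.
by split; [apply: (@k_smooth 1)|apply: (@k_smooth 2)] => x t;
  case: g_frame => _ _ _ -> _; rewrite mxE.
Qed.

Let k1_smooth := frame_curvature_smooth.1.
Let k2_smooth := frame_curvature_smooth.2.

Let u x t := hopf (y x t) 0 0.
Let v x t := hopf (y x t) 1 0.
Let w x t := hopf (y x t) 2 0.

Let nx := is_derive_hopf_x y_sol y_neq0.
Let nt := is_derive_hopf_t k1_smooth k2_smooth y_sol y_neq0.

(** gamma_xx = k1 e_1 + k2 e_2, and its cross product with e_0 on the left is k1 e_2 - k2 e_1. *)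
Let gamma_t x t : dt gamma x t = g x t *m col3 0 (- k2 x t / 2) (k1 x t / 2).
Proof.
rewrite gamma_sol.2.
have -> : dx (dx gamma) x t = g x t *m (Mx x t *m delta_mx 0 0).
  apply: dxE; under eq_fun do rewrite gamma_x.
  have := is_derive_mulmx (g_x x t) (is_derive_cst (delta_mx 0 0 : 'cV[R]_3) x 1).
  by rewrite mulmx0 addr0 mulmxA.
rewrite gamma_x cross_mulmx // scalemxAr; congr (_ *m _).
by apply: col3P; rewrite !mxE ?sum3 !mxE /=; field.
Qed.

(** The new tangent e_0 + 2c (a n x e_0 + b ((n . e_0) n - e_0)) in frame coordinates; the
    curvatures have cancelled. *)
Let A x t := col3 (1 - 2 * b * c * (1 - u x t ^+ 2))
  (c * (2 * a * w x t + 2 * b * u x t * v x t))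
  (c * (- 2 * a * v x t + 2 * b * u x t * w x t)).

Let gt_x (x t : R) : is_derive x 1 (gamma_tilde gamma g alpha y ^~ t) (g x t *m A x t).
Proof.
under eq_fun do rewrite gamma_tildeE.
have H := is_deriveD (Ck_dx x t (gamma_sol.1 1%N))
  (is_deriveZ c (is_derive_mulmx (g_x x t) (nx x t))).
apply: (is_derive_eq H); rewrite gamma_x -mulmxA -mulmxDr scalemxAr -mulmxDr.
congr (_ *m _).
by rewrite /A /u /v /w; apply: col3P; rewrite !mxE ?sum3 !mxE /=; ring.
Qed.

Let dA x t := let ux := k1 x t * v x t + k2 x t * w x t - 2 * b * (1 - u x t ^+ 2) in
  let vx := 2 * a * w x t - k1 x t * u x t + 2 * b * u x t * v x t in
  let wx := - 2 * a * v x t - k2 x t * u x t + 2 * b * u x t * w x t in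
  col3 (4 * b * c * u x t * ux)
    (c * (2 * a * wx + 2 * b * (ux * v x t + u x t * vx)))
    (c * (- 2 * a * vx + 2 * b * (ux * w x t + u x t * wx))).

Let A_x (x t : R) : is_derive x 1 (A ^~ t) (dA x t).
Proof.
have D3 p q r (i : 'I_3) (z : R) : col3 p q r i 0 = z ->
    is_derive x 1 (fun s => hopf (y s t)) (col3 p q r) ->
    is_derive x 1 (fun s => hopf (y s t) i 0) z.
  by move=> <- /is_derive_mxP.
have Hu := D3 _ _ _ 0 _ (mxE _ _ _ _) (nx x t).
have Hv := D3 _ _ _ 1 _ (mxE _ _ _ _) (nx x t).
have Hw := D3 _ _ _ 2 _ (mxE _ _ _ _) (nx x t).
rewrite /= in Hu Hv Hw.
apply/is_derive_mxP => i j; rewrite ord1 {j}; move: i.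
apply: ord3P; under eq_fun do rewrite mxE /=; rewrite mxE /=.
- have D := is_deriveB (is_derive_cst (1 : R) x 1) (is_deriveZ (2 * b * c)
    (is_deriveB (is_derive_cst (1 : R) x 1) (is_deriveM Hu Hu))).
  apply: (is_derive_eq D).
  rewrite /GRing.scale /= -/(u x t) -/(v x t) -/(w x t) /GRing.scale /=.
  by ring.
- have D := is_deriveZ c (is_deriveD (is_deriveZ (2 * a) Hw)
    (is_deriveM (is_deriveZ (2 * b) Hu) Hv)).
  apply: (is_derive_eq D).
  rewrite /GRing.scale /= -/(u x t) -/(v x t) -/(w x t) /GRing.scale /=.
  by ring.
- have D := is_deriveZ c (is_deriveD (is_deriveZ (- 2 * a) Hv)
    (is_deriveM (is_deriveZ (2 * b) Hu) Hw)).
  apply: (is_derive_eq D).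
  rewrite /GRing.scale /= -/(u x t) -/(v x t) -/(w x t) /GRing.scale /=.
  by ring.
Qed.

Lemma backlund_smooth : smooth (gamma_tilde gamma g alpha y).
Proof.
have -> : gamma_tilde gamma g alpha y =
    fun x t => gamma x t + c *: (g x t *m hopf (y x t)).
  by apply/funext => x; apply/funext => t; exact: gamma_tildeE.
move=> n; apply: CkD; first exact: gamma_sol.1.
have hopf_n := @hopf_smooth _ _ _ _ _ k1_smooth k2_smooth y_sol y_neq0 n.
have HG := Ck_mulmx (g_smooth n) hopf_n.
apply/Ck_mxP => i j; under eq_fun do under eq_fun do rewrite mxE.
apply: CkM; first exact: Ck_cst.
by move/Ck_mxP: HG; apply.
Qed.

Lemma backlund_vfe : vfe_solution (gamma_tilde gamma g alpha y).
Proof.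
split; first exact: backlund_smooth.
move=> x t.
have -> : dx (gamma_tilde gamma g alpha y) = fun x t => g x t *m A x t.
  by apply/funext => r; apply/funext => s; exact: dxE (gt_x r s).
have -> : dx (fun x t => g x t *m A x t) x t = g x t *m (Mx x t *m A x t + dA x t).
  apply: dxE.
  have D := is_derive_mulmx (g_x x t) (A_x x t).
  by apply: (is_derive_eq D); rewrite -mulmxA -mulmxDr.
rewrite cross_mulmx // scalemxAr.
apply: dtE.
have -> : gamma_tilde gamma g alpha y x =
    fun t => gamma x t + c *: (g x t *m hopf (y x t)).
  by apply/funext => s; exact: gamma_tildeE.
have D := is_deriveD (Ck_dt x t (gamma_sol.1 1%N))
  (is_deriveZ c (is_derive_mulmx (g_t x t) (nt x t))).
apply: (is_derive_eq D); rewrite gamma_t -mulmxA -mulmxDr scalemxAr -mulmxDr.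
congr (_ *m _).
have ab0 : a ^+ 2 + b ^+ 2 != 0.
  apply: contra alpha_nonreal => /eqP e0.
  rewrite [alpha]complex_eta complex_real -/b; apply/eqP; nra.
(* The definition of c and the unit length of n are put in the form monomial = remainder, so that
   [field] can eliminate c a^2 and w^2. *)
have hc : c * a ^+ 2 = b - c * b ^+ 2 by rewrite /c; field.
have hw : w x t ^+ 2 = 1 - u x t ^+ 2 - v x t ^+ 2.
  by rewrite -(hopf_unit y_neq0 x t) -/(u x t) -/(v x t) -/(w x t); ring.
move: hw; rewrite /A /dA /u /v /w => hw.
(* All quantities are generalized to independent variables, which leaves one polynomial identity per
   frame coordinate, modulo [hc] and [hw]. *)
apply: col3P; move: hc hw; do 3!(rewrite ?mxE ?sum3 /=); rewrite -/a -/b;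
  move: (hopfU _ / hopfN _) (hopfV _ / hopfN _) (hopfW _ / hopfN _) => U V W;
  move: c a b (k1 x t) (k2 x t) (dx k1 x t) (dx k2 x t) => c' a' b' l1 l2 p1 p2;
  move=> hc hw.
- by field: hw hc.
- by field: hw hc.
- by field: hw hc.
Qed.
End backlund.

Theorem theorem6p9 (R : realType) (gamma : R -> R -> 'cV[R]_3)
    (g : R -> R -> 'M[R]_3) (k1 k2 : R -> R -> R)
    (alpha : R[i]) (y : R -> R -> 'cV[R[i]]_2)
    (gamma_sol : vfe_solution gamma)
    (gamma_arc : arc_length gamma)
    (g_frame : adapted_pframe gamma g k1 k2)
    (alpha_nonreal : alpha \isn't Num.real)
    (y_sol : lax_solution alpha (q_of k1 k2) y)
    (y_nontrivial : exists x t, y x t != 0) :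
  vfe_solution (gamma_tilde gamma g alpha y).
Proof.
have [k1_smooth k2_smooth] := frame_curvature_smooth g_frame.
have [x0 [t0 y0]] := y_nontrivial.
apply: (backlund_vfe gamma_sol g_frame alpha_nonreal y_sol) => x t.
(* Being nonzero at one point, y is nonzero on the whole plane, so |y|^2 can be divided by
   everywhere. *)
by apply: (@lax_solution_neq0 _ _ _ _ _ k1_smooth k2_smooth y_sol x0 t0).
Qed.
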